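(* Let $n\ge 2$, $m\ge 1$ and $t\ge 1$ be integers. If $m\equiv 1 \pmod{n-1}$, then $$R(P_n, K_m^t) = (t - 1)(n - 1) + t(m - 1) + 1.$$
   Context: For graphs $G$ and $H$, the Ramsey number $R(G,H)$ is the minimum $N$ such that every colouring of the edges of $K_N$ with the colours red and blue contains either a red copy of $G$ or a blue copy of $H$ (copies are not necessarily induced subgraphs). $P_n$ is the path on $n$ vertices. $K_m^t$ denotes the balanced complete $t$-partite graph with parts of size $m$: its vertex set is partitioned into $t$ sets of size $m$ each, and two vertices are adjacent if and only if they lie in different sets. *)

(* Defs.v *)
From mathcomp Require Import all_boot.

Set Implicit Arguments.
Unset Strict Implicit.
Unset Printing Implicit Defensive.

Record sgraph := SGraph {
  vertex :> finType;
  adj : rel vertex;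
  adj_sym : symmetric adj;
  adj_irrefl : irreflexive adj }.

Lemma path_adj_sym n : symmetric (fun i j : 'I_n => (i.+1 == j) || (j.+1 == i)).
Proof. by move=> i j; rewrite orbC. Qed.

Lemma path_adj_irrefl n :
  irreflexive (fun i j : 'I_n => (i.+1 == j) || (j.+1 == i)).
Proof. by move=> i; rewrite orbb gtn_eqF. Qed.

(* P_n has n vertices (hence n - 1 edges). *)
Definition path_graph (n : nat) : sgraph :=
  SGraph (@path_adj_sym n) (@path_adj_irrefl n).

Lemma multipartite_adj_sym m t :
  symmetric (fun u v : 'I_t * 'I_m => u.1 != v.1).
Proof. by move=> u v; rewrite eq_sym. Qed.

Lemma multipartite_adj_irrefl m t :
  irreflexive (fun u v : 'I_t * 'I_m => u.1 != v.1).
Proof. by move=> u; rewrite eqxx. Qed.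

(* K_m^t: the vertex (i, a) is the a-th element of the i-th part. *)
Definition balanced_multipartite (m t : nat) : sgraph :=
  SGraph (@multipartite_adj_sym m t) (@multipartite_adj_irrefl m t).

Definition colour := bool.
Definition red : colour := true.
Definition blue : colour := false.

(* The edges of K_N are the two-element subsets of 'I_N; the values of a
   colouring on the other subsets are never used. *)
Definition colouring (N : nat) := {set 'I_N} -> colour.

Definition has_mono_copy (N : nat) (c : colouring N) (k : colour) (G : sgraph) :
    Prop :=
  exists f : G -> 'I_N,
    injective f /\ forall u v : G, adj u v -> c [set f u; f v] = k.

Definition arrows (N : nat) (G H : sgraph) : Prop :=
  forall c : colouring N, has_mono_copy c red G \/ has_mono_copy c blue H.

(* R(G, H) = N: N is the minimum of {N' | arrows N' G H}. *)
Definition is_ramsey_number (G H : sgraph) (N : nat) : Prop :=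
  arrows N G H /\ forall N' : nat, arrows N' G H -> N <= N'.

(* Main.v *)
Require Import Defs.
From mathcomp Require Import all_boot.
From mathcomp Require Import zify.

Set Implicit Arguments.
Unset Strict Implicit.
Unset Printing Implicit Defensive.

(** Write [d = n - 1] and [m = k * d + 1].

    Lower bound.  Split [(t * k.+1).-1 * d] vertices, or fewer, into
    [(t * k.+1).-1] blocks of at most [d] vertices, and colour an edge red when
    it lies inside a block.  A red path stays in one block, so it has at most
    [d] vertices.  In a blue [K_m^t] two parts never meet the same block, while
    a part, having more than [k * d] vertices, meets at least [k.+1] blocks; so
    the [t] parts would need [t * k.+1] blocks.  The congruence on [m] is what
    makes the number of vertices a multiple of [d]: full blocks then use up
    exactly the vertices below the claimed value.

    Upper bound, valid for every [m > 0].  Explore the red graph by depth-first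
    search: at each moment the vertices are split into finished ones, a red path
    (the stack) and unvisited ones, with no red edge from finished to unvisited.
    A stack has at most [n - 1] vertices, and right after a vertex has been
    finished, hence popped, at most [n - 2].  Stop when the [m]-th vertex is
    finished ([dfs_separation]): the finished vertices form one part, and at
    most [m + n - 2] vertices have been used up.  This is exactly the difference
    between the claimed values for [t] and for [t - 1], so the other parts come
    by induction from the unvisited vertices ([far_parts]). *)

(** * Separating vertices by depth-first search *)

Section Separation.

Variables (T : eqType) (e : rel T).

Definition far (x y : T) := (x != y) && ~~ e y x.

(** The three sequences are the finished vertices, the stack (top first) and the
    unvisited vertices of a depth-first search on [w]. *)
Definition dfs_state (w s p u : seq T) :=
  [/\ perm_eq (s ++ p ++ u) w, sorted e p & allrel (fun x y => ~~ e y x) s u].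

(** Pushing neighbours of the top of the stack must stop, since [u] shrinks; the
    top then has no neighbour left in [u] and can be finished.  The conclusion
    shows the stack as it was just before that pop, because the bound on path
    lengths applies to [x :: p]. *)
Lemma dfs_finish_next (w s p u : seq T) :
  dfs_state w s p u -> 0 < size (p ++ u) ->
  exists x p' u', dfs_state w (x :: s) p' u' /\ sorted e (x :: p').
Proof.
have [k] := ubnP (size u); elim: k p u => // k IHk p u lt_u_k st pu_gt0.
have push y : y \in u -> sorted e (y :: p) ->
    exists x p' u', dfs_state w (x :: s) p' u' /\ sorted e (x :: p').
  case: st => perm_w _ /allrelP s_u y_u path_yp.
  apply: (IHk (y :: p) (rem y u)) => //.
    by rewrite size_rem //; case: (u) y_u lt_u_k.
  split=> //.
    rewrite -(permPr perm_w) perm_cat2l -cat1s -catA perm_catCA perm_cat2l.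
    by rewrite perm_sym perm_to_rem.
  by apply/allrelP=> a b a_s b_u; apply: s_u => //; apply: mem_rem b_u.
case: p st pu_gt0 push => [|x p] st pu_gt0 push.
  case: u pu_gt0 push {lt_u_k st} => // y u _ push.
  by apply: (push y); rewrite ?mem_head.
case: (boolP (has (fun y => e y x) u)) => [/hasP[y y_u e_yx]|no_nbr].
  by apply: (push y) => //=; rewrite e_yx; case: st.
case: st => perm_w path_xp s_u; exists x, p, u; split=> //; split.
- by rewrite -(permPr perm_w) -cat1s -catA perm_catCA.
- exact: path_sorted path_xp.
- by rewrite allrel_consl s_u andbT all_predC.
Qed.

Lemma dfs_separation (l k : nat) (w : seq T) :
    (forall p, sorted e p -> uniq p -> size p <= l.+1) ->
    uniq w -> k + l <= size w ->
  exists s p u, [/\ dfs_state w s p u, size p <= l & size s = k].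
Proof.
move=> short uniq_w; elim: k => [|k IHk] le_w.
  by exists [::], [::], w; split=> //; split.
have [s [p [u [st le_p sz_s]]]] := IHk (ltnW le_w).
have pu_gt0 : 0 < size (p ++ u).
  by case: st => /perm_size; rewrite size_cat; lia.
have [x [p' [u' [st' path_xp']]]] := dfs_finish_next st pu_gt0.
exists (x :: s), p', u'; split=> //; last by rewrite /= sz_s.
apply: (short (x :: p')) => //.
case: st' => perm_w _ _; move: uniq_w; rewrite -(perm_uniq perm_w) /=.
rewrite mem_cat negb_or mem_cat negb_or cat_uniq cat_uniq.
by case/and3P=> /and3P[_ -> _] _ /and3P[_ -> _].
Qed.

(** The stack left over when the [m]-th vertex is finished has at most [l]
    vertices; discarding it together with the [m] finished ones costs [l + m]
    vertices for each part but the last. *)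
Lemma far_parts (l m t : nat) (w : seq T) :
    (forall p, sorted e p -> uniq p -> size p <= l.+1) ->
    uniq w -> t * (l + m) + m <= size w ->
  exists parts : seq (seq T),
    [/\ size parts = t.+1,
        forall s, s \in parts -> [/\ size s = m, uniq s & {subset s <= w}]
      & pairwise (allrel far) parts].
Proof.
move=> short; elim: t w => [|t IHt] w uniq_w le_w.
  exists [:: take m w]; split=> // s; rewrite inE => /eqP->.
  split; [by rewrite size_takel | exact: take_uniq | exact: mem_take].
have le_ml : m + l <= size w by move: le_w; rewrite mulSn; lia.
have [s [p [u [[perm_w _ s_u] le_p sz_s]]]] := dfs_separation short uniq_w le_ml.
move: (uniq_w); rewrite -(perm_uniq perm_w) !cat_uniq has_cat negb_or.
case/and3P=> uniq_s /andP[_ u_s] /and3P[_ _ uniq_u].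
have le_u : t * (l + m) + m <= size u.
  by move: (perm_size perm_w) le_w; rewrite !size_cat mulSn; lia.
have [parts [sz_parts parts_u far_p]] := IHt u uniq_u le_u.
exists (s :: parts); split=> [|s'|]; first by rewrite /= sz_parts.
- rewrite inE => /predU1P[->|/parts_u[-> -> sub_u]]; split=> // x.
    by rewrite -(perm_mem perm_w) mem_cat => ->.
  by move/sub_u; rewrite -(perm_mem perm_w) !mem_cat => ->; rewrite !orbT.
- rewrite pairwise_cons far_p andbT; apply/allP=> s' /parts_u[_ _ sub_u].
  apply/allrelP=> x y x_s /sub_u y_u; rewrite /far (allrelP s_u) // andbT.
  by apply: contra u_s => /eqP eq_xy; apply/hasP; exists y; last rewrite /= -eq_xy.
Qed.

End Separation.

(** * The upper bound *)

Lemma red_path_of_sorted (N n : nat) (c : colouring N) (p : n.-tuple 'I_N) :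
    sorted (fun x y => c [set x; y]) p -> uniq p ->
  has_mono_copy c red (path_graph n).
Proof.
move=> path_p uniq_p; exists (tnth p); split; first exact/tuple_uniqP.
have step (i j : 'I_n) : i.+1 == j -> c [set tnth p i; tnth p j].
  move/eqP=> ij; have x0 := tnth p i; rewrite !(tnth_nth x0) -ij.
  by apply: (sortedP x0 path_p); rewrite size_tuple ij.
by move=> i j /orP[/step|/step]; rewrite // setUC.
Qed.

Lemma blue_multipartite_of_parts (N m t : nat) (c : colouring N)
    (parts : seq (seq 'I_N)) :
    size parts = t ->
    (forall s, s \in parts -> size s = m /\ uniq s) ->
    pairwise (allrel (far (fun x y => c [set x; y]))) parts ->
  has_mono_copy c blue (balanced_multipartite m t).
Proof.
move=> sz_parts partsP /(pairwiseP [::]) far_p.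
have part_i (i : 'I_t) : nth [::] parts i \in parts.
  by rewrite mem_nth ?sz_parts.
have [f fE] : exists f : 'I_t * 'I_m -> 'I_N, forall u x0,
    f u = nth x0 (nth [::] parts u.1) u.2.
  have in_part (u : 'I_t * 'I_m) : u.2 < size (nth [::] parts u.1).
    by have [-> _] := partsP _ (part_i u.1).
  exists (fun u : 'I_t * 'I_m =>
            tnth (in_tuple (nth [::] parts u.1)) (Ordinal (in_part u))).
  by move=> u x0; rewrite (tnth_nth x0).
have f_part u : f u \in nth [::] parts u.1.
  have [sz_u _] := partsP _ (part_i u.1).
  by rewrite (fE u (f u)) mem_nth ?sz_u.
have far_lt (u v : 'I_t * 'I_m) :
    u.1 < v.1 -> far (fun x y => c [set x; y]) (f u) (f v).
  move=> lt_uv; apply: (allrelP (far_p u.1 v.1 _ _ lt_uv)) => //;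
    by rewrite inE sz_parts.
have far_neq (u v : 'I_t * 'I_m) :
    u.1 != v.1 -> far (fun x y => c [set x; y]) (f u) (f v).
  rewrite neq_ltn => /orP[/far_lt //|/far_lt].
  by rewrite /far eq_sym setUC.
exists f; split=> [u v eq_f|u v /far_neq/andP[_ /negbTE]]; last by rewrite setUC.
case: (eqVneq u.1 v.1) => [eq1|/far_neq/andP[]]; last by rewrite eq_f eqxx.
have [sz_u uniq_u] := partsP _ (part_i u.1).
move/eqP: eq_f; rewrite (fE u (f u)) (fE v (f u)) -eq1 nth_uniq ?sz_u //.
by move/eqP/val_inj=> eq2; case: u v eq1 eq2 {sz_u uniq_u} => u1 u2 [] /= ? ? -> ->.
Qed.

Lemma arrows_path_multipartite (l m t N : nat) :
  t * (l + m) + m <= N ->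
  arrows N (path_graph l.+2) (balanced_multipartite m t.+1).
Proof.
move=> le_N c; pose e x y := c [set x; y].
case: (boolP [exists p : l.+2.-tuple 'I_N, uniq p && sorted e p]).
  by case/existsP=> p /andP[uniq_p path_p]; left; apply: red_path_of_sorted path_p _.
move=> no_path; right.
have short p : sorted e p -> uniq p -> size p <= l.+1.
  move=> path_p uniq_p; rewrite leqNgt; apply: contra no_path => lt_p.
  have sz_p : size (take l.+2 p) == l.+2 by rewrite size_takel.
  by apply/existsP; exists (Tuple sz_p); rewrite take_uniq ?take_sorted.
have [|parts [sz_parts partsP far_p]] :=
  far_parts (m := m) (t := t) short (enum_uniq 'I_N).
  by rewrite size_enum_ord.
by apply: blue_multipartite_of_parts sz_parts _ far_p => s /partsP[].
Qed.

(** * The lower bound *)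

Lemma card_le_blocks (A B O : finType) (phi : A -> B * O) :
  injective phi -> #|A| <= #|[set (phi a).1 | a : A]| * #|O|.
Proof.
move=> phi_inj; rewrite -(card_codom phi_inj) -[#|O|]cardsT -cardsX.
apply/subset_leq_card/subsetP=> _ /codomP[a ->].
by rewrite (surjective_pairing (phi a)) in_setX in_setT andbT;
  apply/imsetP; exists a.
Qed.

Lemma sum_card_disjoint (I B : finType) (F : I -> {set B}) :
    (forall i j b, b \in F i -> b \in F j -> i = j) ->
  \sum_i #|F i| <= #|B|.
Proof.
move=> disjF; under eq_bigr => i _ do rewrite -sum1_card big_mkcond.
rewrite exchange_big -[#|B|]sum1_card /=; apply: leq_sum => b _.
rewrite -big_mkcond sum1_card; apply/card_le1_eqP=> i j bFi bFj.
exact: (disjF _ _ b).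
Qed.

Section BlockColouring.

(** A vertex [x] lies in the block [(phi x).1], so an injective [phi] says that
    each of the [#|B|] blocks has at most [#|O|] vertices. *)
Variables (N : nat) (B O : finType) (phi : 'I_N -> B * O).
Hypothesis phi_inj : injective phi.

Definition block_colouring : colouring N :=
  fun A => [forall x in A, forall y in A, (phi x).1 == (phi y).1].

Lemma block_colouringE x y :
  block_colouring [set x; y] = ((phi x).1 == (phi y).1).
Proof.
apply/forall_inP/idP => [same|/eqP same z].
  have /forall_inP := same x (set21 x y); apply; exact: set22.
rewrite !inE => z_xy; apply/forall_inP=> z'; rewrite !inE => z'_xy.
by case/orP: z_xy => /eqP->; case/orP: z'_xy => /eqP->; rewrite ?same.
Qed.

Lemma no_red_path (l : nat) :
  #|O| <= l -> ~ has_mono_copy block_colouring red (path_graph l.+1).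
Proof.
move=> le_O [f [f_inj f_red]].
have one_block (i : 'I_l.+1) : (phi (f i)).1 = (phi (f ord0)).1.
  case: i => i; elim: i => [|i IHi] lt_i.
    by congr (phi (f _)).1; apply: val_inj.
  rewrite -(IHi (ltnW lt_i)); apply/eqP; rewrite -block_colouringE.
  by apply: f_red; rewrite /= eqxx orbT.
have := card_le_blocks (inj_comp phi_inj f_inj).
have -> : [set ((phi \o f) i).1 | i : 'I_l.+1] = [set (phi (f ord0)).1].
  apply/setP=> b; rewrite inE; apply/imsetP/eqP => [[i _ ->]|->].
    exact: one_block.
  by exists ord0.
by rewrite cards1 mul1n card_ord ltnNge le_O.
Qed.

Lemma no_blue_multipartite (k m t : nat) :
    k * #|O| < m -> #|B| < t * k.+1 ->
  ~ has_mono_copy block_colouring blue (balanced_multipartite m t).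
Proof.
move=> lt_m lt_B [g [g_inj g_blue]].
pose blocks (i : 'I_t) := [set (phi (g (i, a))).1 | a : 'I_m].
have many_blocks i : k < #|blocks i|.
  have inj_i : injective (fun a : 'I_m => phi (g (i, a))).
    by move=> a a' /phi_inj/g_inj[].
  have := leq_trans lt_m (leq_trans _ (card_le_blocks inj_i)).
  by rewrite card_ord leqnn => /(_ isT); rewrite ltn_mul2r => /andP[].
have disj i j b : b \in blocks i -> b \in blocks j -> i = j.
  case/imsetP=> a _ -> /imsetP[a' _ /eqP].
  rewrite -block_colouringE; case: (eqVneq i j) => // neq_ij.
  by rewrite (g_blue (i, a) (j, a')).
have := sum_card_disjoint disj; rewrite leqNgt => /negP; apply.
apply: leq_trans lt_B _.
rewrite -[X in X * _]card_ord -sum_nat_const.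
by apply: leq_sum => i _; apply: many_blocks.
Qed.

End BlockColouring.

Lemma not_arrows_path_multipartite (d k m t N : nat) :
    k * d < m -> 0 < t -> N <= (t * k.+1).-1 * d ->
  ~ arrows N (path_graph d.+1) (balanced_multipartite m t).
Proof.
move=> lt_m t_gt0; set q := _.-1 => le_N.
have card_qd : q * d = #|{: 'I_q * 'I_d}| by rewrite card_prod !card_ord.
pose phi x : 'I_q * 'I_d := enum_val (cast_ord card_qd (widen_ord le_N x)).
have phi_inj : injective phi.
  by move=> x y /enum_val_inj/cast_ord_inj/(congr1 val)/= /val_inj.
move/(_ (block_colouring phi)) => [].
  by apply: no_red_path; rewrite ?card_ord.
apply: (no_blue_multipartite phi_inj (k := k)); rewrite card_ord //.
by rewrite /q prednK // muln_gt0 t_gt0.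
Qed.

Theorem theorem4p1 (n m t : nat) (hn : 2 <= n) (hm : 1 <= m) (ht : 1 <= t)
    (hmod : m = 1 %[mod n - 1]) :
  is_ramsey_number (path_graph n) (balanced_multipartite m t)
    ((t - 1) * (n - 1) + t * (m - 1) + 1).
Proof.
case: n hn hmod => [|[|l]] // _ hmod; case: t ht => // t _.
split=> [|N arrN]; first by apply: arrows_path_multipartite; nia.
have /dvdnP[k mE] : l.+1 %| m - 1 by rewrite -eqn_mod_dvd //;
  apply/eqP; rewrite hmod subn1.
rewrite leqNgt; apply/negP=> lt_N.
by apply: (not_arrows_path_multipartite (k := k) _ _ _ arrN) => //; nia.
Qed.
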